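(* Let $X$ be a topological space. The following are equivalent: (1) $X$ satisfies $\mathsf{U}_{\mathrm{fin}}(\mathcal{O},\mathrm{T}^* )$. (2) $X$ satisfies $\mathsf{S}_{\mathrm{fin}}(\mathcal{O},\mathcal{O})$, and $\Lambda=\gimel(\mathrm{T}^* )$. (3) ONE has no winning strategy in the game $\mathsf{G}_{\mathrm{fin}}(\Omega,\gimel(\mathrm{T}^* ))$. (4) $X$ satisfies $\mathsf{S}_{\mathrm{fin}}(\Omega,\gimel(\mathrm{T}^* ))$. (5) For each positive integer $k$, $\Omega\to\lceil\gimel(\mathrm{T}^* )\rceil^2_k$ holds. (6) $\Omega\to\lceil\gimel(\mathrm{T}^* )\rceil^2_2$ holds.
   Context: Convention: a cover of the topological space $X$ is always a countable collection $\mathcal{U}$ of open subsets of $X$ such that $\bigcup\mathcal{U}=X$ and $X\notin\mathcal{U}$. $\mathscr{A},\mathscr{B}$ denote families of such covers of the underlying space $X$. $\mathcal{O}$ is the family of all covers of $X$. $\mathcal{U}$ is a large cover if each $x\in X$ belongs to infinitely many $U\in\mathcal{U}$; $\Lambda$ is the family of all large covers of $X$. $\mathcal{U}$ is an $\omega$-cover if $X\notin\mathcal{U}$ and for each finite $F\subseteq X$ there is $U\in\mathcal{U}$ with $F\subseteq U$; $\Omega$ is the family of all $\omega$-covers of $X$. $[\mathbb{N}]^{\aleph_0}$ is the set of infinite subsets of $\mathbb{N}$. For $A,B\in[\mathbb{N}]^{\aleph_0}$, $A\subseteq^*B$ means that $A\setminus B$ is finite. A family $Y\subseteq[\mathbb{N}]^{\aleph_0}$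 is linearly refinable if for each $y\in Y$ there is an infinite subset $\hat y\subseteq y$ such that the family $\hat Y=\{\hat y:y\in Y\}$ is linearly ordered by $\subseteq^*$ (any two of its elements are $\subseteq^*$-comparable). A cover $\mathcal{U}=\{U_n:n\in\mathbb{N}\}$ of $X$ (bijectively enumerated) is a $\tau^*$-cover of $X$ if the family $\{\{n:x\in U_n\}:x\in X\}$ is (a subset of $[\mathbb{N}]^{\aleph_0}$ and) linearly refinable. $\mathrm{T}^*$ is the family of all $\tau^*$-covers of $X$. A cover $\mathcal{U}$ of $X$ is multifinite if there is a partition of $\mathcal{U}$ into infinitely many finite covers of $X$. $\gimel(\mathscr{A})$ is the family of all covers $\mathcal{U}$ of $X$ such that either $\mathcal{U}$ is multifinite, or there is a partition $\mathcal{P}$ of $\mathcal{U}$ into finite sets such that $\{\bigcup\mathcal{F}:\mathcal{F}\in\mathcal{P}\}\setminus\{X\}\in\mathscr{A}$. $\mathsf{S}_{\mathrm{fin}}(\mathscr{A},\mathscr{B})$: for each sequence $\{\mathcal{U}_n\}_{n\in\mathbb{N}}$ of members of $\mathscr{A}$ there are finite subsets $\mathcal{F}_n\subseteq\mathcal{U}_n$, $n\in\mathbb{N}$, such that $\bigcup_n\mathcal{F}_n\in\mathscr{B}$. $\mathsf{U}_{\mathrm{fin}}(\mathscr{A},\mathscr{B})$: for each sequence $\{\mathcal{U}_n\}_{n\in\mathbb{N}}$ of elements of $\mathscr{A}$ which do not contain a finite subcover, there are finite (possibly empty) subsets $\mathcal{F}_n\subseteq\mathcal{U}_n$, $n\in\mathbb{N}$,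 such that $\{\bigcup\mathcal{F}_n:n\in\mathbb{N}\}\in\mathscr{B}$. $\mathsf{G}_{\mathrm{fin}}(\mathscr{A},\mathscr{B})$ is the game of two players, ONE and TWO, with an inning for each natural number $n$: in the $n$th inning ONE chooses $\mathcal{U}_n\in\mathscr{A}$ and TWO answers with a finite subset $\mathcal{F}_n\subseteq\mathcal{U}_n$. TWO wins if $\bigcup_n\mathcal{F}_n\in\mathscr{B}$; otherwise ONE wins. $[A]^n$ denotes the set of $n$-element subsets of $A$. For a positive integer $k$, the Baumgartner-Taylor partition relation $\mathscr{A}\to\lceil\mathscr{B}\rceil^2_k$ is the statement: for each $A\in\mathscr{A}$ and each $f:[A]^2\to\{1,\dots,k\}$ there are $B\subseteq A$ with $B\in\mathscr{B}$, a partition of $B$ into finite pieces $B=\bigcup_{n\in\mathbb{N}}B_n$, and $j\in\{1,\dots,k\}$, such that $f(\{U,V\})=j$ for all $U,V\in B$ which do not belong to the same $B_n$. *)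

(* Defs.v *)
(* MathComp-Analysis *)
From mathcomp Require Import ssreflect ssrfun ssrbool eqtype ssrnat seq fintype.
From mathcomp Require Import all_classical topology.

Set Implicit Arguments.
Unset Strict Implicit.
Unset Printing Implicit Defensive.

Local Open Scope classical_set_scope.

Section Covers.
Context (X : topologicalType).
Implicit Types (U F : set (set X)) (A B : set (set (set X))).

Definition open_covers : set (set (set X)) := fun U =>
  [/\ countable U, U `<=` open, \bigcup_(V in U) V = [set: X] & ~ U [set: X]].

Definition large_covers : set (set (set X)) := fun U =>
  open_covers U /\ forall x, infinite_set [set V | U V /\ V x].

Definition omega_covers : set (set (set X)) := fun U =>
  open_covers U /\
  forall S : set X, finite_set S -> exists2 V, U V & S `<=` V.

Definition almost_subset (a b : set nat) : Prop := finite_set (a `\` b).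

Definition linearly_refinable (Y : set (set nat)) : Prop :=
  exists hat : set nat -> set nat,
    (forall y, Y y -> infinite_set (hat y) /\ hat y `<=` y) /\
    (forall y z, Y y -> Y z ->
       almost_subset (hat y) (hat z) \/ almost_subset (hat z) (hat y)).

Definition tau_star_covers : set (set (set X)) := fun U =>
  open_covers U /\
  exists u : nat -> set X,
    [/\ set_bij [set: nat] U u,
        forall x, infinite_set [set n | u n x]
      & linearly_refinable [set y | exists x, y = [set n | u n x]]].

(* The infinitely many pieces are indexed by nat, which loses nothing since a
   cover is countable.  Pieces covering a nonempty space are nonempty, hence
   pairwise distinct; when X is empty, its only cover, the empty one, is
   multifinite. *)
Definition multifinite U : Prop :=
  exists P : nat -> set (set X),
    [/\ \bigcup_n P n = U, trivIset [set: nat] P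
      & forall n, finite_set (P n) /\ open_covers (P n)].

Definition gimel A : set (set (set X)) := fun U =>
  open_covers U /\
  (multifinite U \/
   exists P : set (set (set X)),
     [/\ partition P id U, forall F, P F -> finite_set F
       & A ([set \bigcup_(V in F) V | F in P] `\ [set: X])]).

Definition Sfin A B : Prop :=
  forall U : nat -> set (set X), (forall n, A (U n)) ->
  exists F : nat -> set (set X),
    (forall n, finite_set (F n) /\ F n `<=` U n) /\ B (\bigcup_n F n).

Definition has_finite_subcover U : Prop :=
  exists F, [/\ finite_set F, F `<=` U & \bigcup_(V in F) V = [set: X]].

Definition Ufin A B : Prop :=
  forall U : nat -> set (set X),
  (forall n, A (U n) /\ ~ has_finite_subcover (U n)) ->
  exists F : nat -> set (set X),
    (forall n, finite_set (F n) /\ F n `<=` U n) /\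
    B [set \bigcup_(V in F n) V | n in [set: nat]].

(* A strategy for ONE in G_fin(A, B) maps the finite sequence of TWO's previous
   answers to ONE's next move; only its values on positions where TWO has played
   legally matter.  It is winning when, against every legal play F of TWO, all
   of ONE's moves are legal and TWO does not win.  Since TWO may always answer
   with the empty set, every legal position occurs in such an infinite play. *)
Definition ONE_winning_strategy A B
    (sigma : seq (set (set X)) -> set (set X)) : Prop :=
  forall F : nat -> set (set X),
  (forall n, finite_set (F n) /\ F n `<=` sigma (mkseq F n)) ->
  (forall n, A (sigma (mkseq F n))) /\ ~ B (\bigcup_n F n).

Definition ONE_wins_Gfin A B : Prop :=
  exists sigma, ONE_winning_strategy A B sigma.

(* The Baumgartner-Taylor relation.  A coloring is a function on sets of open
   sets, only evaluated at pairs [set V; W] with V <> W in C: distinctness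
   holds because V and W share no piece.  For k > 0, every coloring of the
   two-element subsets of C extends to such a function.  The pieces P n may be
   empty. *)
Definition BT_relation A B (k : nat) : Prop :=
  forall C : set (set X), A C ->
  forall f : set (set X) -> 'I_k,
  exists D : set (set X), D `<=` C /\ B D /\
  exists (P : nat -> set (set X)) (j : 'I_k),
    [/\ \bigcup_n P n = D, trivIset [set: nat] P,
        forall n, finite_set (P n)
      & forall V W, D V -> D W -> ~ (exists n, P n V /\ P n W) ->
          f [set V; W] = j].

End Covers.

Arguments open_covers : clear implicits.
Arguments large_covers : clear implicits.
Arguments omega_covers : clear implicits.
Arguments tau_star_covers : clear implicits.

(* Main.v *)
Require Import Defs.
From mathcomp Require Import ssreflect ssrfun ssrbool eqtype ssrnat seq choice fintype.
From mathcomp Require Import all_classical topology.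
From mathcomp Require Import zify.

(** All six properties are compared with one property of sequences of
increasing open covers.  Enumerating a countable cover and taking unions of its
initial segments turns it into an increasing sequence of open sets, and a
finite subset of the cover becomes a number; a sequence of covers without
finite subcovers becomes a tower A, where A n m grows with m to X without ever
reaching it.  [tau_star_selectable] asks, for each tower, for numbers f n such
that the family of the sets of those n for which x lies in A n (f n) is
linearly refinable.  Linear refinability survives finite-to-one changes of
index and enlargements of the sets ([lin_refinable_transport]), and this is
nearly all that is used about it.

U_fin(O, T-star) is this property up to the demand that the chosen sets be
distinct ([tower_distinct]).  It yields the Menger property at once, and it
yields that large covers are in gimel(T-star) ([large_gimel]).  For this, cut an
enumeration of the large cover into consecutive finite blocks, so long that the
selected sets are each contained in two adjacent blocks; since the refined index
sets form a chain, all of them are infinite on the even numbers or all are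
infinite on the odd ones, hence the blocks can be merged in pairs.  If no tail
of the enumeration is free of finite subcovers, then the cover is multifinite.

The game is beaten by the theorem of Hurewicz that in a Menger space ONE has no
winning strategy, proved here with the extra demand that each point be covered
infinitely often ([beating_play]).  Given a strategy, x is in [caught n t M]
when it gets covered within n innings after the position t provided that TWO
answers one of them with a number at least M.  These sets are open and increase
to X with M, so the Menger property gives bounds for each position t, and TWO
only has to exceed at each inning the bounds of the finitely many earlier
positions.

The partition relation follows from the game: an ultrafilter consisting of sets
that meet the omega-cover in omega-covers ([omega_ultrafilter]) assigns to each
element V the color of almost all pairs containing V, and it selects one color
that almost all elements V have.  ONE always offers what is compatible with the
earlier answers of TWO.

Conversely, a member of gimel(T-star) made of finitely many small pieces of each
level of a tower yields a selection for the tower ([gimel_selection]).  The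
selection principle provides such a member directly.  The partition relation
provides it when it is applied to the cover by the sets A 0 n & A n k and to the
coloring that compares the numbers n: one color would force D to lie below a
single A 0 n, and the other one makes D finite on each level. *)

Set Implicit Arguments.
Unset Strict Implicit.
Unset Printing Implicit Defensive.

(** * Finite sets and sequences of natural numbers *)

Section Combinatorics.
Local Open Scope classical_set_scope.

(** The form in which finiteness is used throughout: finitely many thresholds
have a common upper bound. *)
Lemma finite_uniform {T : Type} (E : set T) (P : T -> nat -> Prop) :
  finite_set E -> (forall v m m', m <= m' -> P v m -> P v m') ->
  (forall v, E v -> exists m, P v m) -> exists M, forall v, E v -> P v M.
Proof.
move=> finE monoP exP.
have /choice[m mP] : forall v, exists m, E v -> P v m.
  move=> v; case: (pselect (E v)) => [/exP[m Pm]|nE]; first by exists m.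
  by exists 0.
have /finite_seqP[s sE] := finite_image m finE.
exists (foldr maxn 0 s) => v Ev; apply: (monoP _ (m v)); last exact: mP.
have : m v \in s by have : [set` s] (m v) by rewrite -sE; exists v.
elim: s {sE} => //= a s IH; rewrite inE => /orP[/eqP->|/IH]; lia.
Qed.

Lemma infinite_image {T U : Type} (g : T -> U) (a : set T) :
  (forall j, finite_set (a `&` g @^-1` [set j])) ->
  infinite_set a -> infinite_set (g @` a).
Proof.
move=> gfin ainf fin_ga; apply: ainf.
apply: (@sub_finite_set _ _ (\bigcup_(j in g @` a) (a `&` g @^-1` [set j]))).
  by move=> n an; exists (g n) => //; exists n.
exact: bigcup_finite.
Qed.

Lemma almost_subset_image (g : nat -> nat) (a b : set nat) :
  almost_subset a b -> almost_subset (g @` a) (g @` b).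
Proof.
move=> /(finite_image g); apply: sub_finite_set => j [[n an <-] nb].
by exists n => //; split=> // bn; apply: nb; exists n.
Qed.

(** The index [loc n] is that of the block of the interval partition given by d
which contains n; the numbers below [d 0] are attached to the first block. *)
Lemma increasing_locate (d : nat -> nat) : (forall i, d i < d i.+1) ->
  exists loc : nat -> nat,
    forall n, d (loc n) <= maxn n (d 0) /\ n < d (loc n).+1.
Proof.
move=> dS.
suff /choice[loc locP] : forall n, exists i, d i <= maxn n (d 0) /\ n < d i.+1.
  by exists loc.
elim=> [|n [i [di nd]]].
  by exists 0; split; [lia|have := dS 0; lia].
have [lt|ge] := ltnP n.+1 (d i.+1); first by exists i; split; lia.
by exists i.+1; split; [lia|have := dS i.+1; lia].
Qed.

Lemma nondecreasing_le (d : nat -> nat) : (forall i, d i <= d i.+1) ->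
  forall i j, i <= j -> d i <= d j.
Proof.
move=> dS i j /subnK <-; elim: (j - i) => // k IH; rewrite addSn.
by have := dS (k + i); lia.
Qed.

Lemma infinite_image_inj {T U : Type} (g : T -> U) (a : set T) :
  {in a &, injective g} -> infinite_set a -> infinite_set (g @` a).
Proof.
move=> ginj; apply: infinite_image => j.
case: (pselect (exists2 x, a x & g x = j)) => [[x ax gx]|nx].
  apply: (@sub_finite_set _ _ [set x]) => // y [ay gy].
  by apply: ginj; rewrite ?inE// gx gy.
by apply: (@sub_finite_set _ _ set0) => // y [ay gy]; apply: nx; exists y.
Qed.

End Combinatorics.

(** * Linearly refinable sequences of sets *)

Section LinearlyRefinableSequences.
Local Open Scope classical_set_scope.
Context {X : topologicalType}.
Implicit Types (w : nat -> set X) (C : set (set X)).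

(** Linear refinability of the family of the sets of those n with x in [w n], with
the refinements indexed by the points instead of by the members of the
family, and without any injectivity of w. *)
Definition lin_refinable w : Prop :=
  exists h : X -> set nat,
    (forall x, infinite_set (h x) /\ forall n, h x n -> w n x) /\
    (forall x y, almost_subset (h x) (h y) \/ almost_subset (h y) (h x)).

(** Images under a finite-to-one map of infinite sets are infinite, and taking
images preserves almost inclusion, so the images of the old refinements serve
as the new ones. *)
Lemma lin_refinable_transport (g : nat -> nat) w w' :
  (forall j, finite_set (g @^-1` [set j])) -> (forall n, w n `<=` w' (g n)) ->
  lin_refinable w -> lin_refinable w'.
Proof.
move=> gfin ww' [h [hP hlin]]; exists (fun x => g @` h x); split=> [x|x y].
  have [hinf hw] := hP x; split=> [|_ [n hn <-]]; last exact/ww'/hw.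
  by apply: infinite_image => // j; apply: finite_setIr.
by have [le|le] := hlin x y; [left|right]; apply: almost_subset_image.
Qed.

(** If some refinement [h x0] is almost contained in the odd numbers, then the
refinements below it are so too, and those above it contain almost all of it:
every refinement has infinitely many odd elements. *)
Lemma lin_refinable_parity w : lin_refinable w ->
  exists e : bool, lin_refinable (fun i => w (i.*2 + e)).
Proof.
move=> [h [hP hlin]]; pose h' (e : bool) x := [set i | h x (i.*2 + e)].
have h'S e x y : almost_subset (h x) (h y) -> almost_subset (h' e x) (h' e y).
  move=> /(@finite_preimage _ _ _ (fun i => i.*2 + e)); apply.
  by move=> i j _ _ /addIn/double_inj.
have h'inf x : ~ (finite_set (h' false x) /\ finite_set (h' true x)).
  move=> [f0 f1]; apply: (proj1 (hP x)).
  apply: (@sub_finite_set _ _ ((fun i => i.*2 + false) @` h' false x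
      `|` (fun i => i.*2 + true) @` h' true x)); last first.
    by rewrite finite_setU; split; apply: finite_image.
  move=> n hn; have nE := odd_double_half n; rewrite addnC in nE.
  by case: (odd n) nE => nE; [right|left]; exists n./2; rewrite /h' /= nE.
suff [e einf] : exists e, forall x, infinite_set (h' e x).
  exists e, (h' e); split=> [x|x y].
    by split=> // n; apply: (proj2 (hP x)).
  by case: (hlin x y) => /h'S; [left|right].
case: (pselect (exists x0, finite_set (h' false x0))) => [[x0 fin0]|]; last first.
  by move=> nex; exists false => x finx; apply: nex; exists x.
exists true => x finx.
have fin_of z t e : almost_subset (h' e z) (h' e t) -> finite_set (h' e t) ->
    finite_set (h' e z).
  move=> fzt ft; apply: (@sub_finite_set _ _ ((h' e z `\` h' e t) `|` h' e t)).
    by move=> i hi; case: (pselect (h' e t i)); [right|left].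
  by rewrite finite_setU.
case: (hlin x x0) => [/(h'S false)|/(h'S true)] le.
  by apply: (h'inf x); split=> //; apply: fin_of le fin0.
by apply: (h'inf x0); split=> //; apply: fin_of le finx.
Qed.

Lemma tau_star_enum C : tau_star_covers X C ->
  exists u, set_bij [set: nat] C u /\ lin_refinable u.
Proof.
move=> [_ [u [ubij _ [hat [hatP hatlin]]]]]; exists u; split=> //.
exists (fun x => hat [set n | u n x]); split=> [x|x y].
  by have [] := hatP [set n | u n x] (ex_intro _ x erefl).
by apply: hatlin; [exists x|exists y].
Qed.

(** A point of X is recovered from its index set by choice; the option type
accounts for index sets of no point, as X may be empty. *)
Lemma tau_star_range w : injective w -> (forall n, open (w n)) ->
  (forall n, w n <> setT) -> lin_refinable w -> tau_star_covers X (range w).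
Proof.
move=> winj wopen wT [h [hP hlin]].
have wx x : exists n, w n x.
  by have [/infinite_setN0[n hn] hw] := hP x; exists n; apply: hw.
split; first split.
- exact: card_image_le.
- by move=> _ [n _ <-].
- by apply/seteqP; split=> // x _; have [n wnx] := wx x; exists (w n) => //; exists n.
- by move=> [n _ /wT].
exists w; split.
- by split=> // m n _ _ /winj.
- by move=> x; have [hinf hw] := hP x; apply: sub_infinite_set hinf => n /hw.
have /choice[pt ptP] : forall y : set nat, exists x : option X,
    (exists x, y = [set n | w n x]) ->
    exists2 x0, x = Some x0 & y = [set n | w n x0].
  move=> y; case: (pselect (exists x, y = [set n | w n x])) => [[x yE]|ny].
    by exists (Some x) => _; exists x.
  by exists None.
exists (fun y => if pt y is Some x then h x else set0); split=> [y /ptP[x -> ->]|].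
  by have [? hw] := hP x; split=> // n /hw.
by move=> y z /ptP[x -> _] /ptP[t -> _].
Qed.

(** The new set is put in front of an enumeration, which shifts the refinements
by one. *)
Lemma tau_star_setU1 C (Z : set X) : open Z -> Z <> setT ->
  tau_star_covers X C -> tau_star_covers X (C `|` [set Z]).
Proof.
move=> Zopen ZT Ctau.
case: (pselect (C Z)) => [CZ|nCZ].
  rewrite (_ : _ `|` _ = C)//; apply/seteqP; split=> [V [//|->//]|V CV].
  by left.
have [[_ Copen _ CT] _] := Ctau.
have [u [[uC uinj usurj] uref]] := tau_star_enum Ctau.
pose w n := if n is n'.+1 then u n' else Z.
have -> : C `|` [set Z] = range w.
  apply/seteqP; split=> [V [/usurj[n _ <-]|->]|_ [[|n] _ <-]] /=.
  - by exists n.+1.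
  - by exists 0.
  - by right.
  - by left; apply: uC.
apply: tau_star_range.
- move=> [|m] [|n] //= e.
  + by case: nCZ; rewrite e; apply: uC.
  + by case: nCZ; rewrite -e; apply: uC.
  + by congr _.+1; apply: uinj e; rewrite inE.
- by case=> [//|n] /=; apply/Copen/uC.
- by case=> [//|n] /= e; apply: CT; rewrite -e; apply: uC.
apply: (lin_refinable_transport (g := succn) _ _ uref) => [j|n x //].
by apply: finite_preimage => // m n _ _ -[].
Qed.

End LinearlyRefinableSequences.

(** * Towers of open sets, the Hurewicz-type selection and the Menger property *)

Section Towers.
Local Open Scope classical_set_scope.
Context {X : topologicalType}.
Implicit Types (C F : set (set X)) (A : nat -> nat -> set X).

Definition increasing_open_covers A : Prop :=
  [/\ forall n m, open (A n m), forall n m, A n m `<=` A n m.+1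
    & forall n x, exists m, A n m x].

Definition tower A : Prop :=
  increasing_open_covers A /\ forall n m, A n m <> setT.

Lemma increasing_le A : increasing_open_covers A ->
  forall n m m', m <= m' -> A n m `<=` A n m'.
Proof.
move=> [_ AS _] n m m' /subnK <-; elim: (m' - m) => // k IH x /IH; rewrite addSn.
exact: AS.
Qed.

Definition tau_star_selectable : Prop :=
  forall A, tower A -> exists f : nat -> nat, lin_refinable (fun n => A n (f n)).

(** The Menger property for sequences of increasing covers, which here may contain
X itself. *)
Definition menger_selectable : Prop :=
  forall A, increasing_open_covers A ->
  exists f : nat -> nat, forall x, exists n, A n (f n) x.

(** A code is an injective numbering of a countable cover, so a segment is a
finite block of an enumeration; codes need not be onto, which spares the
distinction between finite and infinite covers. *)
Definition segment C (code : set X -> nat) (lo hi : nat) : set (set X) :=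
  [set V | C V /\ lo <= code V < hi].

Lemma finite_segment C code lo hi :
  {in C &, injective code} -> finite_set (segment C code lo hi).
Proof.
move=> inj; apply: (@sub_finite_set _ _ (C `&` code @^-1` `I_hi)).
  by move=> V [CV /andP[_ lt]].
rewrite -[_ `&` _](_ : (fun V => if pselect (C V) then code V else hi) @^-1` `I_hi = _).
  apply: finite_preimage => // V W; rewrite !inE /=.
  by do 2 case: pselect => ? //=; rewrite ?ltnn// => _ _; apply: inj; rewrite inE.
apply/seteqP; split=> V /=; case: pselect => CV //=; first by rewrite ltnn.
  by move=> [].
by move=> [].
Qed.

(** Finite subsets of an increasing cover are bounded by one of its members. *)
Lemma Ufin_selectable :
  Ufin (open_covers X) (tau_star_covers X) -> tau_star_selectable.
Proof.
move=> HU A [Ainc AT]; have [Aop AS Acov] := Ainc.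
have bounded n F : finite_set F -> F `<=` range (A n) ->
    exists m, forall V, F V -> V `<=` A n m.
  move=> finF FA; apply: (@finite_uniform _ F (fun V m => V `<=` A n m)) => //.
    by move=> V m m' le Vm x /Vm; apply: increasing_le.
  by move=> V /FA[m _ <-]; exists m.
have [F [FP Ftau]] : exists F : nat -> set (set X),
    (forall n, finite_set (F n) /\ F n `<=` range (A n)) /\
    tau_star_covers X [set \bigcup_(V in F n) V | n in [set: nat]].
  apply: HU => n; split; first split.
  - exact: card_image_le.
  - by move=> _ [m _ <-].
  - apply/seteqP; split=> // x _; have [m Ax] := Acov n x.
    by exists (A n m) => //; exists m.
  - by move=> [m _ /AT].
  move=> [F [finF FA FT]]; have [m Fm] := bounded n F finF FA.
  apply: (AT n m); apply/seteqP; split=> // x _.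
  have [V FV Vx] : (\bigcup_(V in F) V) x by rewrite FT.
  exact: Fm Vx.
have /choice[f fP] n : exists m, \bigcup_(V in F n) V `<=` A n m.
  have [finF FA] := FP n; have [m Fm] := bounded n _ finF FA.
  by exists m => x [V /Fm Vm Vx]; apply: Vm.
exists f; have [u [[uC uinj _] uref]] := tau_star_enum Ftau.
have /choice[s sP] k : exists n, \bigcup_(V in F n) V = u k.
  by have [n _ <-] := uC k I; exists n.
apply: lin_refinable_transport uref => [j|k]; last first.
  by have := fP (s k); rewrite sP; apply.
apply: finite_preimage => // k l _ _ skl; apply: uinj; rewrite ?inE//.
by rewrite -!sP skl.
Qed.

(** At stage n, one point outside each of the earlier chosen sets gets included
in the new one. *)
Lemma tower_distinct A (f : nat -> nat) : tower A ->
  exists2 f' : nat -> nat, (forall n, f n <= f' n) & injective (fun n => A n (f' n)).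
Proof.
move=> [Ainc AT]; have [_ _ Acov] := Ainc.
have /choice[p pP] nm : exists x, ~ A nm.1 nm.2 x.
  by apply/existsNP => all; apply: (AT nm.1 nm.2); apply/seteqP; split.
(* s lists the values of f' chosen so far *)
have /choice[next nextP] s : exists m, f (size s) <= m /\
    forall i, i < size s -> A (size s) m (p (i, nth 0 s i)).
  have [m mP] : exists m, forall i, i < size s -> A (size s) m (p (i, nth 0 s i)).
    apply: (@finite_uniform _ `I_(size s)) => // i m m' le.
    exact: increasing_le.
  exists (maxn m (f (size s))); split=> [|i ilt]; first lia.
  by apply: (increasing_le Ainc _ (mP _ ilt)); lia.
pose hist := fix hist n := if n is n'.+1 then rcons (hist n') (next (hist n')) else [::].
pose f' n := next (hist n).
have histE n : hist n = mkseq f' n by elim: n => // n IH; rewrite mkseqS -IH.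
have f'P n : f n <= f' n /\ forall i, i < n -> A n (f' n) (p (i, f' i)).
  have := nextP (hist n); rewrite -/(f' n) histE size_mkseq => -[? fi]; split=> // i lt.
  by have := fi i lt; rewrite nth_mkseq.
exists f' => [n|]; first exact: (proj1 (f'P n)).
have ne i n : i < n -> A i (f' i) <> A n (f' n).
  by move=> lt e; apply: (pP (i, f' i)) => /=; rewrite e; apply: (proj2 (f'P n)).
by move=> m n e; case: (ltngtP m n) => // /ne; rewrite e.
Qed.

Lemma segment_tower (U : nat -> set (set X)) (code : nat -> set X -> nat) :
  (forall n, open_covers X (U n)) ->
  increasing_open_covers (fun n m => \bigcup_(V in segment (U n) (code n) 0 m) V).
Proof.
move=> Ucov; split=> n.
- move=> m; apply: bigcup_open => V [UV _]; have [_ + _ _] := Ucov n; exact.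
- by move=> m x [V [UV lt] Vx]; exists V => //; split=> //; lia.
move=> x; have [_ _ Ux _] := Ucov n.
have [V UV Vx] : (\bigcup_(V in U n) V) x by rewrite Ux.
by exists (code n V).+1; exists V => //; split=> //; lia.
Qed.

Lemma countable_codes (U : nat -> set (set X)) : (forall n, open_covers X (U n)) ->
  exists code : nat -> set X -> nat, forall n, {in U n &, injective (code n)}.
Proof.
move=> Ucov; have /choice[code codeP] n : exists c : set X -> nat, {in U n &, injective c}.
  by have [/countable_injP] := Ucov n.
by exists code.
Qed.

Lemma selectable_Ufin :
  tau_star_selectable -> Ufin (open_covers X) (tau_star_covers X).
Proof.
move=> star U UP; have Ucov n := proj1 (UP n).
have [code codeP] := countable_codes Ucov.
set A := fun n m => \bigcup_(V in segment (U n) (code n) 0 m) V.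
have Ainc : increasing_open_covers A by apply: segment_tower.
have Atower : tower A.
  split=> // n m AT; apply: (proj2 (UP n)); exists (segment (U n) (code n) 0 m).
  by split=> //; [exact: finite_segment|move=> V []].
have [f [h [hP hlin]]] := star _ Atower.
have [f' ff' f'inj] := tower_distinct f Atower.
exists (fun n => segment (U n) (code n) 0 (f' n)); split=> [n|].
  by split; [exact: finite_segment|move=> V []].
apply: (@tau_star_range _ (fun n => A n (f' n))) => //.
- by move=> n; have [+ _ _] := Ainc; apply.
- by move=> n; apply: (proj2 Atower).
exists h; split=> // x; have [? hA] := hP x; split=> // n /hA.
exact: increasing_le.
Qed.

Lemma selectable_menger : tau_star_selectable -> menger_selectable.
Proof.
move=> star A Ainc.
case: (pselect (exists n m, A n m = setT)) => [[n [m e]]|ne].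
  by exists (fun=> m) => x; exists n; rewrite e.
have [|f [h [hP _]]] := star A.
  by split=> // n m e; apply: ne; exists n, m.
exists f => x; have [/infinite_setN0[n hn] hA] := hP x.
by exists n; apply: hA.
Qed.

Lemma menger_Sfin : menger_selectable -> Sfin (open_covers X) (open_covers X).
Proof.
move=> menger U Ucov; have [code codeP] := countable_codes Ucov.
have [f fP] := menger _ (segment_tower code Ucov).
exists (fun n => segment (U n) (code n) 0 (f n)); split=> [n|].
  by split; [exact: finite_segment|move=> V []].
split.
- apply: bigcup_countable => [|n _]; first exact: card_lexx.
  exact/finite_set_countable/finite_segment.
- by move=> V [n _ [UV _]]; have [_ + _ _] := Ucov n; apply.
- apply/seteqP; split=> // x _; have [n [V VF Vx]] := fP x.
  by exists V => //; exists n.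
by move=> [n _ [UT _]]; have [_ _ _] := Ucov n; apply.
Qed.

Lemma Sfin_menger : Sfin (open_covers X) (open_covers X) -> menger_selectable.
Proof.
move=> HS A Ainc; have [Aop _ Acov] := Ainc.
case: (pselect (exists n m, A n m = setT)) => [[n [m e]]|ne].
  by exists (fun=> m) => x; exists n; rewrite e.
have [n|F [FP [_ _ FT _]]] := HS (fun n => range (A n)).
  split.
  - exact: card_image_le.
  - by move=> _ [m _ <-].
  - apply/seteqP; split=> // x _; have [m Ax] := Acov n x.
    by exists (A n m) => //; exists m.
  - by move=> [m _ e]; apply: ne; exists n, m.
have /choice[f fP] n : exists m, forall V, F n V -> V `<=` A n m.
  have [finF FA] := FP n.
  apply: (@finite_uniform _ (F n) (fun V m => V `<=` A n m)) => //.
    by move=> V m m' le Vm x /Vm; apply: increasing_le.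
  by move=> V /FA[m _ <-]; exists m.
exists f => x; have [V [n _ FV] Vx] : (\bigcup_(V in \bigcup_n F n) V) x by rewrite FT.
by exists n; apply: fP Vx.
Qed.

End Towers.

(** * Large covers and gimel(T-star) *)

Section Gimel.
Local Open Scope classical_set_scope.
Context {X : topologicalType}.
Implicit Types (C D F U : set (set X)) (A : nat -> nat -> set X).

(** A point meets infinitely many pieces of the partition, and elements of
distinct pieces are distinct. *)
Lemma gimel_large : gimel (tau_star_covers X) `<=` large_covers X.
Proof.
move=> U [Ucov Upart]; split=> // x.
case: Upart => [[P [PU Ptriv PP]]|[P [[PU Ptriv _] _ Ptau]]].
  have /choice[v vP] n : exists V, P n V /\ V x.
    have [_ [_ _ PT _]] := PP n.
    by have [V PV Vx] : (\bigcup_(V in P n) V) x by [rewrite PT]; exists V.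
  have vinj : {in [set: nat] &, injective v}.
    move=> m n _ _ vmn; apply: Ptriv => //; exists (v m).
    by split; [have [] := vP m|rewrite vmn; have [] := vP n].
  apply: sub_infinite_set (infinite_image_inj vinj infinite_nat) => _ [n _ <-].
  by have [PV Vx] := vP n; split=> //; rewrite -PU; exists n.
have [_ [u [[uC uinj _] uinf _]]] := Ptau.
have /choice[Q QP] n : exists F, P F /\ \bigcup_(V in F) V = u n.
  by have [[F PF <-] _] := uC n I; exists F.
have /choice[v vP] n : exists V, u n x -> Q n V /\ V x.
  case: (pselect (u n x)) => [|nx]; last by exists set0.
  by have [_ <-] := QP n; move=> [V QV Vx]; exists V.
have vinj : {in [set n | u n x] &, injective v}.
  move=> m n; rewrite !inE => /vP[Qm _] /vP[Qn _] vmn.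
  apply: uinj; rewrite ?inE//; have [Pm <-] := QP m; have [Pn <-] := QP n.
  by congr (\bigcup_(V in _) V); apply: Ptriv => //; exists (v m); split=> //; rewrite vmn.
apply: sub_infinite_set (infinite_image_inj vinj (uinf x)) => _ [n /vP[QV Vx] <-].
by split=> //; rewrite -PU; exists (Q n) => //; have [] := QP n.
Qed.

Lemma trivIset_segment C code (d : nat -> nat) : (forall i, d i <= d i.+1) ->
  trivIset [set: nat] (fun i => segment C code (d i) (d i.+1)).
Proof.
move=> /nondecreasing_le dle i j _ _ [V [[_ Vi] [_ Vj]]].
by case: (ltngtP i j) => // /dle; lia.
Qed.

Lemma bigcup_segment C code (d : nat -> nat) : (forall i, d i < d i.+1) ->
  \bigcup_i segment C code (d i) (d i.+1) = [set V | C V /\ d 0 <= code V].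
Proof.
move=> dS; have dle : forall i, d i <= d i.+1 by move=> i; apply: ltnW.
have [loc locP] := increasing_locate dS; apply/seteqP; split=> V.
  by move=> [i _ [CV lt]]; split=> //; have := nondecreasing_le dle (leq0n i); lia.
move=> [CV le]; exists (loc (code V)) => //; split=> //.
by have := locP (code V); lia.
Qed.

Lemma increasing_iter (P : nat -> nat -> Prop) (N : nat) :
  (forall m, exists m', m < m' /\ P m m') ->
  exists d : nat -> nat, [/\ d 0 = N, forall i, d i < d i.+1
    & forall i, P (d i) (d i.+1)].
Proof.
move=> /choice[next nextP]; exists (fun i => iter i next N).
by split=> // i; have [] := nextP (iter i next N).
Qed.

(** Each block is continued until it covers X. *)
Lemma multifinite_segments U code : open_covers X U -> {in U &, injective code} ->
  (forall m, exists m', \bigcup_(V in segment U code m m') V = setT) ->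
  multifinite U.
Proof.
move=> [Ucount Uop UT nUT] inj cov.
have [m|d [d0 dS dP]] := @increasing_iter
    (fun m m' => \bigcup_(V in segment U code m m') V = setT) 0.
  have [m' m'T] := cov m; exists (maxn m' m.+1); split; first lia.
  apply/seteqP; split=> // x _.
  have [V [UV lt] Vx] : (\bigcup_(V in segment U code m m') V) x by rewrite m'T.
  by exists V => //; split=> //; lia.
exists (fun i => segment U code (d i) (d i.+1)); split.
- by rewrite bigcup_segment// d0; apply/seteqP; split=> [V []|].
- by apply: trivIset_segment => i; apply: ltnW.
move=> n; split; first exact: finite_segment.
split=> //.
- exact/finite_set_countable/finite_segment.
- by move=> V [/Uop].
- by move=> [/nUT].
Qed.

Lemma large_segment_covers U code N x : large_covers X U ->
  {in U &, injective code} -> exists2 V, U V /\ N <= code V & V x.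
Proof.
move=> [_ /(_ x) Uinf] inj; apply: contrapT => nV; apply: Uinf.
apply: (@sub_finite_set _ _ (segment U code 0 N)); last exact: finite_segment.
move=> V [UV Vx]; split=> //; have [le|//] := leqP N (code V).
by case: nV; exists V.
Qed.

(** Besides the blocks of d there is the initial block of the codes below [d 0];
its union is X, which the definition of gimel discards, or it is adjoined to the
tau-star cover, or the block is empty and not a piece. *)
Lemma gimel_segments U code (d : nat -> nat) :
  open_covers X U -> {in U &, injective code} -> (forall i, d i < d i.+1) ->
  (forall i, segment U code (d i) (d i.+1) !=set0) ->
  (forall i, \bigcup_(V in segment U code (d i) (d i.+1)) V <> setT) ->
  tau_star_covers X
    (range (fun i => \bigcup_(V in segment U code (d i) (d i.+1)) V)) ->
  gimel (tau_star_covers X) U.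
Proof.
move=> Ucov inj dS dn0 dT dtau; split=> //; right.
pose L := segment U code 0 (d 0).
(* the initial block is the block 0 of d', possibly empty *)
pose d' i := if i is i'.+1 then d i' else 0.
pose P i := segment U code (d' i) (d' i.+1).
have d'S i : d' i <= d' i.+1 by case: i => //= i; apply: ltnW.
exists [set F | F !=set0 /\ range P F]; split.
- split.
  + apply/seteqP; split=> V; first by move=> [F [_ [i _ <-]] []].
    move=> UV; have [lt|ge] := ltnP (code V) (d 0).
      have PV : P 0 V by [].
      by exists (P 0) => //; split; [exists V|exists 0].
    have [i _ iV] : (\bigcup_i segment U code (d i) (d i.+1)) V.
      by rewrite bigcup_segment.
    by exists (P i.+1) => //; split; [exists V|exists i.+1].
  + move=> F G [_ [i _ <-]] [_ [j _ <-]] ij; congr P.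
    exact: (trivIset_segment d'S) ij.
  + by move=> F [].
- by move=> _ [_ [i _ <-]]; apply: finite_segment.
case: (pselect (L !=set0 /\ \bigcup_(V in L) V <> setT)) => [[Ln0 LT]|nL].
  rewrite (_ : _ `\` _ = range (fun i => \bigcup_(V in segment U code (d i) (d i.+1)) V)
      `|` [set \bigcup_(V in L) V]); last first.
    apply/seteqP; split=> [V [[_ [_ [[|i] _ <-]] <-]]|V].
    + by right.
    + by left; exists i.
    + move=> [[i _ <-]|->]; split.
      * by exists (P i.+1) => //; split; [exact: dn0|exists i.+1].
      * exact: dT.
      * by exists L => //; split=> //; exists 0.
      * exact: LT.
  apply: tau_star_setU1 => //.
  by apply: bigcup_open => V [UV _]; have [_ + _ _] := Ucov; exact.
rewrite (_ : _ `\` _ = range (fun i => \bigcup_(V in segment U code (d i) (d i.+1)) V))//.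
apply/seteqP; split=> [V [[F [Pn0 [[|i] _ PE]] <-] VT]|_ [i _ <-]].
- case: nL; rewrite -PE in Pn0 VT; split=> //.
- by exists i => //; rewrite -PE.
- split; last exact: dT.
  by exists (P i.+1) => //; split; [exact: dn0|exists i.+1].
Qed.

(** Once no block starting at N covers X, the blocks starting at n, for n above N,
form a tower, since a large cover remains a cover when finitely many elements
are removed.  The cuts b are placed so that the set selected for an n in block
j ends within block j + 1, and so that each block covers a point missed by
everything between N and its start; the latter makes unions distinct. *)
Lemma large_gimel : tau_star_selectable (X := X) ->
  large_covers X `<=` gimel (tau_star_covers X).
Proof.
move=> star U Ularge; have Ucov := proj1 Ularge.
have [/countable_injP[code inj] Uop UT nUT] := Ucov.
pose S m m' := \bigcup_(V in segment U code m m') V.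
case: (pselect (forall m, exists m', S m m' = setT)) => [|/existsNP[N /forallNP NT]].
  by move=> cov; split=> //; left; apply: multifinite_segments cov.
have Sop m m' : open (S m m') by apply: bigcup_open => V [/Uop].
have Ssub m1 m2 m3 m4 : m1 <= m2 -> m3 <= m4 -> S m2 m3 `<=` S m1 m4.
  by move=> ? ? x [V [UV lt] Vx]; exists V => //; split=> //; lia.
pose A n m := S (maxn n N) m.
have Ainc : increasing_open_covers A.
  split=> [n m|n m|n x]; [exact: Sop|apply: Ssub => //; lia|].
  have [V [UV le] Vx] := large_segment_covers (maxn n N) x Ularge inj.
  by exists (code V).+1; exists V => //; split=> //; lia.
have [|f fref] := star A.
  split=> // n m AT; apply: (NT m); apply/seteqP; split=> // x _.
  by apply: (@Ssub _ (maxn n N) m) => //; [lia|rewrite [S _ _]AT].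
have /choice[p pP] m : exists x, ~ S N m x.
  by apply/existsNP => all; apply: (NT m); apply/seteqP; split.
have [m|b [b0 bS bP]] := @increasing_iter
    (fun m m' => (forall n, n < m -> f n <= m') /\ A m m' (p m)) N.
  have [M fM] : exists M, forall n, n < m -> f n <= M.
    apply: (@finite_uniform _ `I_m) => // [n k k'|n _]; first lia.
    by exists (f n).
  have [_ _ /(_ m (p m))[k Ak]] := Ainc.
  exists (maxn m.+1 (maxn M k)); split; first lia.
  split=> [n /fM|]; first lia.
  by apply: increasing_le Ak => //; lia.
have ble := nondecreasing_le (fun i => ltnW (bS i)).
have [loc locP] := increasing_locate bS.
(* the set selected at n lies in the blocks [loc n] and [loc n].+1 *)
have wref : lin_refinable (fun j => S (b j) (b j.+2)).
  apply: (lin_refinable_transport (g := loc) _ _ fref) => [j|n].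
    apply: (@sub_finite_set _ _ `I_(b j.+1)) => // n /= <-.
    by have [] := locP n.
  have [lo hi] := locP n; apply: Ssub; first by rewrite b0 in lo.
  by have [fle _] := bP (loc n).+1; apply: fle.
(* merging the blocks in pairs, with the parity e as offset *)
have [e dref] := lin_refinable_parity wref.
pose d i := b (i.*2 + e).
have dE i : d i.+1 = b (i.*2 + e).+2 by rewrite /d doubleS !addSn.
have dS i : d i < d i.+1 by rewrite dE /d; have := bS (i.*2 + e); have := bS (i.*2 + e).+1; lia.
have dle := nondecreasing_le (fun i => ltnW (dS i)).
have dN i : N <= d i by rewrite -b0; apply: ble.
have dp i : S (d i) (d i.+1) (p (d i)).
  have [_] := bP (i.*2 + e); rewrite dE; apply: Ssub; first exact: leq_maxl.
  exact/ltnW/bS.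
have dT i : S (d i) (d i.+1) <> setT.
  by move=> e1; apply: (pP (d i.+1)); apply: (@Ssub _ (d i) (d i.+1)) => //; rewrite e1.
apply: (@gimel_segments U code d) => //.
  by move=> i; have [V dV _] := dp i; exists V.
apply: tau_star_range => //.
- have ne i j : i < j -> S (d i) (d i.+1) <> S (d j) (d j.+1).
    move=> ij eS; apply: (pP (d j)); apply: (@Ssub _ (d i) (d i.+1)) => //.
      exact: dle.
    by rewrite eS; apply: dp.
  by move=> i j eS; case: (ltngtP i j) => // /ne; rewrite /S eS.
- by move=> i; apply: Sop.
Qed.

(** The rank r says to which level of the tower an element of D belongs.  A piece
of the partition has as its level the least rank of its elements; by
disjointness only finitely many pieces have a given level.  The multifinite case
cannot occur, for a finite cover by sets that lie below members of A 0 would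
have its union below one member. *)
Lemma gimel_selection A D (r : set X -> nat) : tower A ->
  gimel (tau_star_covers X) D ->
  (forall n, finite_set (D `&` r @^-1` [set n])) ->
  (forall V i, D V -> i <= r V -> exists m, V `<=` A i m) ->
  exists f : nat -> nat, lin_refinable (fun n => A n (f n)).
Proof.
move=> [Ainc AT] [_ Dpart] rfin DA.
case: Dpart => [[P [PD _ PP]]|[P [[PD Ptriv Pn0] Pfin Ptau]]].
  have [finP [_ _ PT _]] := PP 0.
  have [m Pm] : exists m, forall V, P 0 V -> V `<=` A 0 m.
    apply: finite_uniform => // [V m m' le Vm x /Vm|V PV]; first exact: increasing_le.
    by apply: DA => //; rewrite -PD; exists 0.
  case: (AT 0 m); apply/seteqP; split=> // x _.
  by have [V PV Vx] : (\bigcup_(V in P 0) V) x by [rewrite PT]; exact: Pm Vx.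
have [u [[uC uinj _] uref]] := tau_star_enum Ptau.
have /choice[Q QP] k : exists F, P F /\ \bigcup_(V in F) V = u k.
  by have [[F PF <-] _] := uC k I; exists F.
have /choice[v vP] k : exists V, Q k V /\ forall W, Q k W -> r V <= r W.
  have [/Pn0[V0 QV0] _] := QP k.
  have ex : exists n, `[< exists2 V, Q k V & r V = n >].
    by exists (r V0); apply/asboolP; exists V0.
  case: (ex_minnP ex) => n /asboolP[V QV <-] min; exists V; split=> // W QW.
  by apply: min; apply/asboolP; exists W.
have vD k : D (v k).
  by rewrite -PD; exists (Q k); [have [] := QP k|have [] := vP k].
have vinj : injective v.
  move=> k l vkl; apply: uinj; rewrite ?inE//.
  have [Pk <-] := QP k; have [Pl <-] := QP l.
  congr (\bigcup_(V in _) V); apply: Ptriv => //; exists (v k).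
  by split; [have [] := vP k|rewrite vkl; have [] := vP l].
have gfin n : finite_set ((r \o v) @^-1` [set n]).
  apply: (@sub_finite_set _ _ (v @^-1` (D `&` r @^-1` [set n]))); first by move=> k.
  by apply: finite_preimage => // k l _ _; apply: vinj.
have /choice[f fP] n : exists m, forall k, r (v k) = n -> u k `<=` A n m.
  apply: finite_uniform (gfin n) _ _ => [k m m' le um x /um|k <-].
    exact: increasing_le.
  have [Pk <-] := QP k; have [_ vmin] := vP k.
  have [m mP] : exists m, forall V, Q k V -> V `<=` A (r (v k)) m.
    apply: finite_uniform (Pfin _ Pk) _ _ => [V m m' le Vm x /Vm|V QV].
      exact: increasing_le.
    by apply: DA; [rewrite -PD; exists (Q k)|apply: vmin].
  by exists m => x [V /mP VA /VA].
exists f; apply: (lin_refinable_transport (g := r \o v) _ _ uref) => // k.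
exact: fP.
Qed.

End Gimel.

(** * Omega-covers from towers *)

Section OmegaCovers.
Local Open Scope classical_set_scope.
Context {X : topologicalType}.
Implicit Types (C D F U : set (set X)) (A : nat -> nat -> set X).

Lemma tower_omega A n : tower A -> omega_covers X (range (A n)).
Proof.
move=> [Ainc AT]; have [Aop _ Acov] := Ainc; split; first split.
- exact: card_image_le.
- by move=> _ [m _ <-].
- apply/seteqP; split=> // x _; have [m Ax] := Acov n x.
  by exists (A n m) => //; exists m.
- by move=> [m _ /AT].
move=> S finS; have [m Sm] : exists m, forall x, S x -> A n m x.
  by apply: finite_uniform => // x m m' /(increasing_le Ainc); apply.
by exists (A n m) => //; exists m.
Qed.

(** Replacing A by its finite meets makes later levels refine the earlier ones. *)
Fixpoint meet_tower A n m : set X :=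
  if n is n'.+1 then meet_tower A n' m `&` A n m else A 0 m.

Lemma meet_tower_sub A n m i : i <= n -> meet_tower A n m `<=` A i m.
Proof.
elim: n => [|n IH]; first by rewrite leqn0 => /eqP->.
by rewrite leq_eqVlt => /orP[/eqP->|/IH le] x [] // /le.
Qed.

Lemma meet_towerP A : tower A -> tower (meet_tower A).
Proof.
move=> [[Aop AS Acov] AT]; have Ainc := And3 Aop AS Acov; split; last first.
  move=> n m e; apply: (AT 0 m); apply/seteqP; split=> // x _.
  by apply: (@meet_tower_sub A n m 0) => //; rewrite e.
have Ble : forall n m m', m <= m' -> meet_tower A n m `<=` meet_tower A n m'.
  elim=> [|n IH] m m' le /=; first exact: increasing_le.
  by apply: setISS; [exact: IH|exact: increasing_le].
split=> [|n m|]; last 1 first.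
- elim=> [|n IH] x /=; first exact: Acov.
  have [m mx] := IH x; have [m' m'x] := Acov n.+1 x.
  exists (maxn m m'); split; first exact: Ble (leq_maxl m m') _ mx.
  by apply: increasing_le m'x => //; lia.
- by elim=> [|n IH] m //=; apply: openI.
- exact: Ble.
Qed.

(** Each set in E that belongs to U misses a point; asking V to contain these points
as well keeps V out of E. *)
Lemma omega_avoid U E S : omega_covers X U -> finite_set E -> finite_set S ->
  exists V, [/\ U V, S `<=` V & ~ E V].
Proof.
move=> [[_ _ _ UT] Uom] finE finS.
have /choice[pt ptP] V : exists T : set X,
    finite_set T /\ (V <> setT -> ~ T `<=` V).
  case: (pselect (V = setT)) => [->|VT]; first by exists set0; split.
  have [x nVx] : exists x, ~ V x.
    by apply/existsNP => all; apply: VT; apply/seteqP; split.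
  by exists [set x]; split=> // _ /(_ x erefl).
have [|V UV SV] := Uom (S `|` \bigcup_(V in E) pt V).
  rewrite finite_setU; split=> //; apply: bigcup_finite => // V _.
  exact: (proj1 (ptP V)).
exists V; split=> // [x Sx|EV]; first by apply: SV; left.
have VT : V <> setT by move=> e; apply: UT; rewrite -e.
by apply: (proj2 (ptP V) VT) => x ptx; apply: SV; right; exists V.
Qed.

Lemma Sfin_selectable : Sfin (omega_covers X) (gimel (tau_star_covers X)) ->
  tau_star_selectable (X := X).
Proof.
move=> HS A Atower; have Btower := meet_towerP Atower.
have [F [FP FD]] := HS _ (fun n => tower_omega n Btower).
have /choice[r rP] V : exists n, (\bigcup_n F n) V -> F n V.
  case: (pselect ((\bigcup_n F n) V)) => [[n _ FV]|]; first by exists n.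
  by exists 0.
apply: (gimel_selection (r := r) Atower FD) => [n|V i DV le].
  apply: (@sub_finite_set _ _ (F n)); last by have [] := FP n.
  by move=> V [/rP + rV]; rewrite rV.
have [_ /(_ V (rP V DV))[m _ <-]] := FP (r V).
by exists m; apply: meet_tower_sub.
Qed.

(** A set B 0 n & B n k of the omega-cover gets the rank n, and a pair is colored
by whether the ranks agree.  If they agreed across pieces, they would agree on
all of D, as D does not fit into one piece; then the union of D would be below
some B 0 n. *)
Lemma partition_selectable :
  BT_relation (omega_covers X) (gimel (tau_star_covers X)) 2 ->
  tau_star_selectable (X := X).
Proof.
move=> BT A Atower; have [[Bop BS Bcov] BT'] := meet_towerP Atower.
set B := meet_tower A in Bop BS Bcov BT'.
have Binc : increasing_open_covers B by split.
pose C := [set V | exists n k, V = B 0 n `&` B n k].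
have Com : omega_covers X C.
  have Cfin S : finite_set S -> exists2 V, C V & S `<=` V.
    move=> finS; have /choice[m mP] n : exists m, forall x, S x -> B n m x.
      by apply: finite_uniform => // x m m' /(increasing_le Binc); apply.
    exists (B 0 (m 0) `&` B (m 0) (m (m 0))); first by exists (m 0), (m (m 0)).
    by move=> x Sx; split; apply: mP.
  split; last exact: Cfin.
  split.
  - rewrite (_ : C = \bigcup_n range (fun k => B 0 n `&` B n k)).
      by apply: bigcup_countable => [|n _]; [exact: card_lexx|exact: card_image_le].
    by apply/seteqP; split=> [V [n [k ->]]|V [n _ [k _ <-]]]; [exists n|exists n, k].
  - by move=> _ [n [k ->]]; apply: openI.
  - apply/seteqP; split=> // x _; have [V CV sV] := Cfin [set x] (finite_set1 x).
    by exists V => //; apply: sV.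
  - move=> [n [k e]]; apply: (BT' 0 n); apply/seteqP; split=> // x _.
    by have : setT x by []; rewrite e => -[].
have /choice[r rP] V : exists n, C V -> exists k, V = B 0 n `&` B n k.
  by case: (pselect (C V)) => [[n Vn]|]; [exists n|exists 0].
pose f (p : set (set X)) : 'I_2 :=
  if pselect (forall V W, p V -> p W -> r V = r W) then ord0 else ord_max.
have fE V W : (f [set V; W] = ord0) <-> r V = r W.
  rewrite /f; case: pselect => same; split=> //.
  - by move=> _; apply: same; [left|right].
  - by move=> rVW; case: same => V' W' [->|->] [->|->].
have [D [DC [Dgim [P [j [PD Ptriv Pfin Phom]]]]]] := BT C Com f.
have [[_ _ DT DnT] Dinf] := gimel_large Dgim.
(* D is infinite, hence leaves every finite piece *)
have out n : exists2 W, D W & ~ P n W.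
  have [x _] : exists x, ~ B 0 0 x.
    by apply/existsNP => all; apply: (BT' 0 0); apply/seteqP; split.
  have [W [[DW _] nPW]] := infinite_setN0 (infinite_setD (Dinf x) (Pfin n)).
  by exists W.
have same_piece V n W m : P n V -> P n W -> P m V -> P m W.
  by move=> nV nW mV; rewrite -(Ptriv n m)//; exists V.
have [j0|jn0] := eqVneq j ord0.
  have [V0 DV0 _] := out 0; have [n0 _ PV0] : (\bigcup_n P n) V0 by rewrite PD.
  have [W0 DW0 nPW0] := out n0.
  have rr V W n : D V -> D W -> P n V -> ~ P n W -> r V = r W.
    move=> DV DW nV nW; apply/fE; rewrite Phom// => -[m [mV mW]].
    by apply: nW; apply: (same_piece _ _ _ _ mV mW).
  (* two elements of the same piece are compared through one outside of it *)
have rE V : D V -> r V = r V0.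
    move=> DV; case: (pselect (P n0 V)) => nV; last by rewrite (rr V0 V n0).
    by rewrite (rr V W0 n0)// (rr V0 W0 n0).
  case: (BT' 0 (r V0)); apply/seteqP; split=> // x _.
  have [V DV Vx] : (\bigcup_(V in D) V) x by rewrite DT.
  by have [k VE] := rP V (DC V DV); move: Vx; rewrite VE rE// => -[].
apply: (gimel_selection (r := r) Atower Dgim) => [n|V i DV le].
  case: (pselect (exists2 V, D V & r V = n)) => [[V DV rV]|nV]; last first.
    by apply: (@sub_finite_set _ _ set0) => // V [DV rV]; apply: nV; exists V.
  have [m _ PV] : (\bigcup_n P n) V by rewrite PD.
  apply: (@sub_finite_set _ _ (P m)) => // W [DW rW].
  apply: contrapT => nW; move/eqP: jn0; apply.
  rewrite -(Phom V W) => [|//|//|[l [lV lW]]]; first by apply/fE; rewrite rV.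
  by apply: nW; apply: (same_piece _ _ _ _ lV lW).
have [k VE] := rP V (DC V DV); exists k => x; rewrite VE => -[_].
exact: meet_tower_sub.
Qed.

End OmegaCovers.

(** * Consequences of the absence of a winning strategy *)

Section Games.
Local Open Scope classical_set_scope.
Context {X : topologicalType}.
Implicit Types (A B : set (set (set X))) (V W : set X).

(** A sequence of covers that defeats every selection is a strategy that ignores
TWO. *)
Lemma game_Sfin A B : ~ ONE_wins_Gfin A B -> Sfin A B.
Proof.
move=> nwin U UA; apply: contrapT => nF; apply: nwin.
exists (fun s => U (size s)) => F FP; split=> [n|FB]; first exact: UA.
by apply: nF; exists F; split=> // n; have := FP n; rewrite size_mkseq.
Qed.

(** The sets of those V in C that contain a given finite S generate a filter, and any
ultrafilter finer than it works. *)
Lemma omega_ultrafilter C : omega_covers X C ->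
  exists p : set_system (set X), [/\ UltraFilter p, p C
    & forall D, p D -> omega_covers X (C `&` D)].
Proof.
move=> Com; have [[Ccount Cop CT nCT] Cfin] := Com.
pose base (S : set X) := [set V | C V /\ S `<=` V].
have base_proper : ProperFilter (filter_from finite_set base).
  apply: filter_from_proper; last by move=> S /Cfin[V CV SV]; exists V.
  apply: filter_from_filter; first by exists set0.
  move=> S T finS finT; exists (S `|` T); first by rewrite finite_setU.
  by move=> V [CV STV]; split; split=> // x xin; apply: STV; [left|right].
have [p [pultra pbase]] := ultraFilterLemma base_proper.
exists p; split=> // [|D pD].
  by apply: pbase; exists set0 => // V [].
have CDfin S : finite_set S -> exists2 V, (C `&` D) V & S `<=` V.
  move=> finS; have pS : p (base S) by apply: pbase; exists S.
  by have [V [DV [CV SV]]] := filter_ex (filterI pD pS); exists V.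
split; last exact: CDfin.
split.
- by apply: sub_countable Ccount; apply: subset_card_le => V [].
- by move=> V [/Cop].
- apply/seteqP; split=> // x _; have [V CDV sV] := CDfin [set x] (finite_set1 x).
  by exists V => //; apply: sV.
- by move=> [/nCT].
Qed.

Lemma ultra_color {T : Type} (p : set_system T) k (c : T -> 'I_k) :
  UltraFilter p -> exists j, p [set V | c V = j].
Proof.
move=> pultra; apply: contrapT => nj.
have : \forall V \near p, forall j, c V <> j.
  apply: filter_forall => j.
  have [pj|//] := in_ultra_setVsetC [set V | c V = j] pultra.
  by case: nj; exists j.
by move=> /filter_ex[V /(_ (c V))].
Qed.

(** At each position, ONE offers the elements of C of the dominant color j that are
compatible with all elements chosen before.  Finitely many conditions from the
ultrafilter are imposed, so the offer is an omega-cover. *)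
Lemma game_partition B k :
  ~ ONE_wins_Gfin (omega_covers X) B -> BT_relation (omega_covers X) B k.
Proof.
move=> nwin C Com f.
have [p [pultra pC pom]] := omega_ultrafilter Com.
have [[_ _ _ nCT] _] := Com.
have /choice[c cP] V : exists j, p [set W | f [set V; W] = j].
  exact: ultra_color.
have [j pj] := ultra_color c pultra.
(* W <> V makes the answers of TWO disjoint; it holds for almost all W because the
   elements of C differ from X *)
pose ok V := [set W | f [set V; W] = c V /\ W <> V].
have pok V : C V -> p (ok V).
  move=> CV; apply: filterI; first exact: cP.
  have [pV|//] := in_ultra_setVsetC [set V] pultra.
  have [[_ _ Vcov _] _] := pom _ pV.
  have [] : False; apply: nCT; rewrite -Vcov (_ : \bigcup_(_ in _) _ = V)//.
  by apply/seteqP; split=> [x [W [_ ->]]|x Vx] //; exists V.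
pose sigma (s : seq (set (set X))) := C `&` [set W | c W = j /\
  forall i, i < size s -> forall V, nth set0 s i V -> ok V W].
have sigmaF F n W : sigma (mkseq F n) W ->
    [/\ C W, c W = j & forall i, i < n -> forall V, F i V -> ok V W].
  move=> [CW [cW okW]]; split=> // i lt V FV.
  by apply: (okW i); rewrite ?size_mkseq// nth_mkseq.
have [F [FP FB]] : exists F : nat -> set (set X),
    (forall n, finite_set (F n) /\ F n `<=` sigma (mkseq F n)) /\ B (\bigcup_n F n).
  apply: contrapT => nF; apply: nwin; exists sigma => F FP; split; last first.
    by move=> FB; apply: nF; exists F.
  move=> n; apply: pom; apply: filterI => //; rewrite size_mkseq.
  have pfin i V : F i V -> p (ok V).
    by move=> FV; apply: pok; have [_ /(_ _ FV)[]] := FP i.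
  suff : \forall W \near p, forall (i : 'I_n) V, F i V -> ok V W.
    apply: filterS => W okW i lt V; rewrite nth_mkseq//.
    exact: (okW (Ordinal lt)).
  apply: filter_forall => i; have [finF _] := FP i.
  have /finite_seqP[s sE] := finF; have sF V : V \in s -> F i V by rewrite sE.
  rewrite /prop_near1 /nbhs /= sE; elim: s sF {sE} => [|V s IH] sF.
    by apply: filterS filterT.
  have pV : p (ok V) by apply: (pfin i); apply: sF; rewrite inE eqxx.
  have ps := IH (fun W Ws => sF W (@mem_behead _ (V :: s) W Ws)).
  apply: filterS (filterI pV ps) => W [okV oks] V' /=.
  by rewrite inE => /orP[/eqP->|/oks].
have FS n W : F n W -> sigma (mkseq F n) W by have [_] := FP n; apply.
exists (\bigcup_n F n); split; first by move=> V [n _ /FS/sigmaF[]].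
split=> //; exists F, j; split=> //.
- move=> m n _ _ [V [mV nV]].
  by case: (ltngtP m n) => // lt; [have [_ _ /(_ _ lt _ mV)[_]] := sigmaF _ _ _ (FS _ _ nV)
    |have [_ _ /(_ _ lt _ nV)[_]] := sigmaF _ _ _ (FS _ _ mV)].
- by move=> n; have [] := FP n.
have hom m n V W : m < n -> F m V -> F n W -> f [set V; W] = j.
  move=> lt mV nW; have [_ _ /(_ _ lt _ mV)[-> _]] := sigmaF _ _ _ (FS _ _ nW).
  by have [] := sigmaF _ _ _ (FS _ _ mV).
move=> V W [m _ mV] [n _ nW] diff.
case: (ltngtP m n) => [lt|lt|e]; first exact: (hom m n).
- by rewrite setUC; apply: (hom n m).
- by case: diff; exists m; split=> //; rewrite e.
Qed.

End Games.

(** * The Menger game *)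

Section MengerGame.
Local Open Scope classical_set_scope.
Context {X : topologicalType}.
Context (sigma : seq (set (set X)) -> set (set X)).
Context (code : set (set X) -> set X -> nat).
Implicit Types (t : seq (set (set X))) (V : set X).

(** Positions of the game, that is, the lists of the answers that TWO has given. *)
Definition legal t : Prop := forall i, i < size t ->
  finite_set (nth set0 t i) /\ nth set0 t i `<=` sigma (take i t).

(** The answer of TWO encoded by a number: an initial segment of what ONE offers,
deprived of earlier choices, since infinitely many distinct elements are to
contain each point.  The countability condition keeps the answers finite at
unreachable positions. *)
Definition answer t a : set (set X) :=
  segment [set V | countable (sigma t) /\ sigma t V /\
             forall i, i < size t -> ~ nth set0 t i V] (code (sigma t)) 0 a.

Definition gain t a : set X := \bigcup_(V in answer t a) V.

(** The point x belongs to this set when TWO covers it within n innings after t,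
whatever the answers are, provided that one of these is encoded by a number at
least M: an answer at least M now suffices, and after an answer a < M either x
is covered already or a later large answer will cover it. *)
Fixpoint caught n t M : set X :=
  if n is n'.+1 then
    gain t M `&` \bigcap_(a in `I_M) (gain t a `|` caught n' (rcons t (answer t a)) M)
  else setT.

Context (codeP : forall U, countable U -> {in U &, injective (code U)}).

Lemma finite_answer t a : finite_set (answer t a).
Proof.
have [cnt|ncnt] := pselect (countable (sigma t)).
  apply: finite_segment => V W; rewrite !inE => -[_ [sV _]] [_ [sW _]].
  by apply: codeP; rewrite ?inE.
by apply: (@sub_finite_set _ _ set0) => // V [[]].
Qed.

Lemma answer_sub t a : answer t a `<=` sigma t.
Proof. by move=> V [[_ []]]. Qed.

Lemma gain_le t a b : a <= b -> gain t a `<=` gain t b.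
Proof.
by move=> le x [V [sV lt] Vx]; exists V => //; split=> //; lia.
Qed.

Lemma legal_rcons t a : legal t -> legal (rcons t (answer t a)).
Proof.
move=> tl i; rewrite size_rcons ltnS leq_eqVlt => /orP[/eqP->|lt].
  rewrite nth_rcons ltnn eqxx -cats1 take_size_cat//.
  by split; [exact: finite_answer|exact: answer_sub].
by rewrite nth_rcons lt -cats1 takel_cat ?(ltnW lt)//; apply: tl.
Qed.

(** The answer M, which the larger bound no longer counts as large, already covers x. *)
Lemma caught_le n t M M' : M <= M' -> caught n t M `<=` caught n t M'.
Proof.
elim: n t => //= n IH t le x [tM rest]; split; first exact: gain_le tM.
move=> a /= aM'; have [lt|ge] := ltnP a M.
  by case: (rest a lt) => [|/IH]; [left|right; auto].
by left; apply: gain_le tM.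
Qed.

Context (omegaP : forall t, legal t -> omega_covers X (sigma t)).

(** An omega-cover deprived of finitely many elements is still a cover. *)
Lemma gain_cover t x : legal t -> exists a, gain t a x.
Proof.
move=> tl; have tom := omegaP tl; have [[cnt _ _ _] _] := tom.
have finE : finite_set [set V | exists2 i, i < size t & nth set0 t i V].
  rewrite (_ : [set V | _] = \bigcup_(i in `I_(size t)) nth set0 t i); last first.
    by apply/seteqP; split=> V [i]; exists i.
  by apply: bigcup_finite => // i /tl[].
have [V [sV Vx nV]] := omega_avoid tom finE (finite_set1 x).
exists (code (sigma t) V).+1; exists V; last exact: Vx.
split; last by rewrite leq0n ltnSn.
by do 2 split=> //; move=> i lt tV; apply: nV; exists i.
Qed.

Lemma open_gain t a : legal t -> open (gain t a).
Proof.
move=> /omegaP[[_ sop _ _] _]; apply: bigcup_open => V /answer_sub.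
exact: sop.
Qed.

Lemma open_caught n t M : legal t -> open (caught n t M).
Proof.
elim: n t => [|n IH] t tl /=; first exact: openT.
apply: openI; first exact: open_gain.
rewrite -closedC setC_bigcap;  apply: (@closed_bigcup X nat) => // a _.
rewrite closedC; apply: openU; first exact: open_gain.
exact/IH/legal_rcons.
Qed.

Lemma caught_cover n t x : legal t -> exists M, caught n t M x.
Proof.
elim: n t => [|n IH] t tl /=; first by exists 0.
have [m mx] := gain_cover x tl.
have [M MP] : exists M, forall a, a < m -> caught n (rcons t (answer t a)) M x.
  apply: (@finite_uniform _ `I_m) => // [a k k' le|a _]; first exact: caught_le.
  exact/IH/legal_rcons.
exists (maxn m M); split; first by apply: gain_le mx; lia.
move=> a _; have [lt|ge] := ltnP a m; last by left; apply: gain_le mx.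
by right; apply: caught_le (MP a lt); lia.
Qed.

(** The number M t n is given by the Menger property for the covers [caught n.+1 t].
TWO answers at the position t with a number above all the bounds
[M (take i t) (size t - i)], so that for every i and n the inning i + n is a
large answer with respect to the n-th bound at the position i. *)
Lemma beating_play : menger_selectable (X := X) -> exists F : nat -> set (set X),
  (forall n, finite_set (F n) /\ F n `<=` sigma (mkseq F n)) /\
  large_covers X (\bigcup_n F n).
Proof.
move=> menger.
have /choice[M MP] t : exists f : nat -> nat,
    legal t -> forall x, exists n, caught n.+1 t (f n) x.
  case: (pselect (legal t)) => [tl|]; last by exists id.
  have [|f fP] := menger (fun n m => caught n.+1 t m); last by exists f.
  split=> [n m|n m|n x]; [exact: open_caught|exact: caught_le|exact: caught_cover].
have /choice[phi phiP] t : exists b, forall i, i <= size t ->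
    M (take i t) (size t - i) <= b.
  apply: (@finite_uniform _ `I_(size t).+1) => // [i m m'|i _]; first lia.
  by exists (M (take i t) (size t - i)).
pose pos k := iter k (fun t => rcons t (answer t (phi t))) [::].
pose F k := answer (pos k) (phi (pos k)).
have posS k : pos k.+1 = rcons (pos k) (F k) by [].
have posE k : pos k = mkseq F k by elim: k => // k IH; rewrite mkseqS -IH.
have pos_size k : size (pos k) = k by rewrite posE size_mkseq.
have pos_take i k : i <= k -> take i (pos k) = pos i.
  elim: k => [|k IH]; first by rewrite leqn0 => /eqP->.
  rewrite leq_eqVlt => /orP[/eqP->|le].
    by rewrite take_oversize// pos_size.
  by rewrite posS -cats1 takel_cat ?IH// pos_size.
have pos_legal k : legal (pos k).
  by elim: k => [//|k IH]; apply: legal_rcons.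
(* a large answer at inning i + n covers x at some inning from i on *)
have catch n : forall i m x, m <= phi (pos (i + n)) -> caught n.+1 (pos i) m x ->
    exists2 k, i <= k & gain (pos k) (phi (pos k)) x.
  elim: n => [|n IH] i m x le [mx rest].
    by exists i => //; apply: gain_le mx; rewrite addn0 in le.
  have [le'|lt] := leqP m (phi (pos i)); first by exists i => //; apply: gain_le mx.
  case: (rest (phi (pos i)) lt) => [now|later]; first by exists i.
  have [|k ik kx] := IH i.+1 m x _ later; first by rewrite addSnnS.
  by exists k => //; apply: ltnW.
have often i x : exists2 k, i <= k & exists2 V, F k V & V x.
  have [n nx] := MP (pos i) (pos_legal i) x; apply: (catch n i _ _ _ nx).
  have := phiP (pos (i + n)) i; rewrite pos_size pos_take ?leq_addr// addKn.
  exact.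
have Fom k : omega_covers X (sigma (pos k)) by apply/omegaP/pos_legal.
exists F; split.
  by move=> k; rewrite -posE; split; [exact: finite_answer|exact: answer_sub].
split; first split.
- apply: bigcup_countable => [|k _]; first exact: card_lexx.
  exact/finite_set_countable/finite_answer.
- move=> V [k _ /answer_sub kV]; have [[_ + _ _] _] := Fom k; exact.
- apply/seteqP; split=> // x _; have [k _ [V FV Vx]] := often 0 x.
  by exists V => //; exists k.
- by move=> [k _ /answer_sub kT]; have [[_ _ _]] := Fom k.
move=> x fin.
have [i iP] : exists i, forall V, (\bigcup_n F n) V /\ V x ->
    exists2 k, k < i & F k V.
  apply: (@finite_uniform _ _ (fun V i => exists2 k, k < i & F k V) fin).
    by move=> V m m' le [k lt FV]; exists k => //; lia.
  by move=> V [[k _ FV] _]; exists k.+1, k.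
have [k ik [V FV Vx]] := often i x.
have [l li FlV] : exists2 l, l < i & F l V by apply: iP; split=> //; exists k.
have [[_ [_ new]] _] := FV; apply: (new l); rewrite ?pos_size; first lia.
by rewrite posE nth_mkseq//; lia.
Qed.

End MengerGame.

Section Winning.
Local Open Scope classical_set_scope.
Context {X : topologicalType}.

(** A legal position is extended to an infinite legal play by empty answers. *)
Lemma winning_omega A B (sigma : seq (set (set X)) -> set (set X)) t :
  ONE_winning_strategy A B sigma -> legal sigma t -> A (sigma t).
Proof.
move=> win tl; pose F := nth set0 t.
have FE n : n <= size t -> mkseq F n = take n t.
  move=> le; apply: (@eq_from_nth _ set0) => [|i].
    by rewrite size_mkseq size_takel.
  by rewrite size_mkseq => lt; rewrite nth_mkseq// nth_take.
have [|+ _] := win F; last by move=> /(_ (size t)); rewrite FE// take_size.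
move=> n; have [lt|ge] := ltnP n (size t).
  by rewrite FE 1?ltnW//; apply: tl.
by rewrite /F nth_default//; split=> // V.
Qed.

Lemma menger_not_winning B : menger_selectable (X := X) ->
  large_covers X `<=` B -> ~ ONE_wins_Gfin (omega_covers X) B.
Proof.
move=> menger largeB [sigma win].
have /choice[code codeP] (U : set (set X)) : exists c : set X -> nat,
    countable U -> {in U &, injective c}.
  case: (pselect (countable U)) => [/countable_injP[c cP]|]; first by exists c.
  by exists (fun=> 0).
have [F [FP /largeB FB]] :=
  beating_play codeP (fun t => winning_omega (t := t) win) menger.
by have [_] := win F FP.
Qed.

End Winning.

(** * The equivalences *)

Unset Implicit Arguments.

Theorem theorem24 (X : topologicalType) :
  [<-> Ufin (open_covers X) (tau_star_covers X);
       Sfin (open_covers X) (open_covers X) /\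
         large_covers X = gimel (tau_star_covers X);
       ~ ONE_wins_Gfin (omega_covers X) (gimel (tau_star_covers X));
       Sfin (omega_covers X) (gimel (tau_star_covers X));
       forall k : nat, (0 < k)%N ->
         BT_relation (omega_covers X) (gimel (tau_star_covers X)) k;
       BT_relation (omega_covers X) (gimel (tau_star_covers X)) 2].
Proof.
have no_win : tau_star_selectable (X := X) ->
    ~ ONE_wins_Gfin (omega_covers X) (gimel (tau_star_covers X)).
  by move=> star; apply: menger_not_winning (selectable_menger star) (large_gimel star).
tfae.
- move=> /Ufin_selectable star; split; first exact/menger_Sfin/selectable_menger.
  apply/seteqP; split; [exact: large_gimel|exact: gimel_large].
- move=> [/Sfin_menger menger large_eq]; apply: menger_not_winning => //.
  by rewrite large_eq.
- exact: game_Sfin.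
- by move=> /Sfin_selectable/no_win win k _; apply: game_partition.
- by apply.
- by move=> /partition_selectable; apply: selectable_Ufin.
Qed.
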